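(* Let $\alpha\ge3$ and $\kappa\ge\omega$ be cardinals, and let $\{X_i:i\in I\}$ be a set of topological spaces such that $|I|^+\ge\kappa$ and $\alpha\le S(X_i)\le\alpha^+$ for each $i\in I$. (a) If $\alpha^+\ge\kappa$ then $\alpha^{<\kappa}\le S((X_I)_\kappa)\le(2^\alpha)^+$; and (b) if $\alpha^+\le\kappa$ then $(2^{<\kappa})^+\le S((X_I)_\kappa)\le((2^{<\kappa})^{<\kappa})^+$.
   Context: No separation axioms are assumed. A cellular family in $X$ is a family of pairwise disjoint nonempty open subsets of $X$; the Souslin number $S(X)$ is the least cardinal $\lambda$ (possibly finite) such that no cellular family in $X$ has cardinality $\lambda$. For an infinite cardinal $\kappa$, $(X_I)_\kappa$ is $X_I:=\prod_{i\in I}X_i$ with the $\kappa$-box topology, whose base consists of all sets $\prod_{i\in I}U_i$ with each $U_i$ open in $X_i$ and $|\{i\in I:U_i\ne X_i\}|<\kappa$. $\alpha^{<\kappa}:=\sum_{\lambda<\kappa}\alpha^\lambda$ (sum over cardinals $\lambda<\kappa$). For a cardinal $\gamma$ (finite or infinite), $\gamma^+$ is the least cardinal greater than $\gamma$. *)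

(* Defs.v *)
From HB Require Import structures.
From mathcomp Require Import all_boot all_order.
From mathcomp Require Import mathcomp_extra boolp classical_sets functions.
From mathcomp Require Import cardinality topology_structure.

Set Implicit Arguments.
Unset Strict Implicit.
Unset Printing Implicit Defensive.

Local Open Scope classical_set_scope.
Local Open Scope card_scope.

(** A cardinal is represented by any type of that cardinality; two types denote
    the same cardinal when each is [<=c] the other (Cantor-Bernstein). *)
Notation "A '<=c' B" := ([set: A] #<= [set: B])
  (at level 70, no associativity).

Definition card_lt T U (A : set T) (B : set U) : Prop :=
  A #<= B /\ ~ (B #<= A).
Notation "A '#<' B" := (card_lt A B) (at level 79, no associativity).
Notation "A '<c' B" := ([set: A] #< [set: B])
  (at level 70, no associativity).

Definition is_least_card (P : Type -> Prop) (L : Type) : Prop :=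
  P L /\ forall M : Type, P M -> L <=c M.

(** The [void] branch is never reached in the two uses below: see [succ_cardP]
    and [souslinP]. *)
Definition least_card (P : Type -> Prop) : Type :=
  if pselect (exists L, is_least_card P L) is left exL then projT1 (cid exL)
  else void.

Definition succ_card (A : Type) : Type := least_card (fun L => A <c L).

Definition card_rep (K : Type) (L : set K) : set K :=
  xget set0 [set M | M #= L].

(** Exactly one subset of [K] for each cardinal smaller than [K]: [card_rep]
    takes the same value on equipotent subsets. *)
Definition cards_below (K : Type) : set (set K) :=
  [set L | L #< [set: K] /\ card_rep L = L].
Arguments cards_below : clear implicits.

(** The weak power [A ^ (< K)], the sum of the [A ^ L] over cardinals [L < K]. *)
Definition wpow (A K : Type) : Type :=
  {L : set_type (cards_below K) & (set_type (val L) -> A)}.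

Section ZornCardinals.

Lemma card_leTP (A B : Type) : (A <=c B) <-> exists f : A -> B, injective f.
Proof.
split=> [/card_leP[f]|[f finj]].
  exists (fun a => set_val (f (to_setT a))) => a b /val_inj fab.
  have := @inj _ _ _ f _ _ (mem_set I) (mem_set I) fab.
  by move=> /(congr1 val).
apply/card_leP/injfunPex; exists (fun a => to_setT (f (set_val a))) => //.
by move=> a b _ _ /(congr1 set_val)/finj/val_inj.
Qed.

Lemma ex_min_card (I : Type) (i0 : I) (T : I -> Type) :
  exists i, forall j, T i <=c T j.
Proof.
pose P := [set Y : set (forall i, T i) |
  forall i f g, Y f -> Y g -> f i = g i -> f = g].
have [F FP Ftot|Y [PY maxY]] := @Zorn_bigcup _ P.
  move=> i f g [A FA Af] [B FB Bg] fg.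
  have [AB|BA] := Ftot _ _ FA FB.
    by apply: (FP _ FB i) => //; exact: AB.
  by apply: (FP _ FA i) => //; exact: BA.
have [[i surji]|nosurj] := pselect (exists i, forall t, exists2 f, Y f & f i = t).
  exists i => j.
  have h t : {f | Y f /\ f i = t}.
    by apply: cid; have [f Yf ft] := surji t; exists f.
  apply/card_leTP; exists (fun t => sval (h t) j) => s t.
  have [Ys hs] := svalP (h s); have [Yt ht] := svalP (h t).
  move=> /(PY _ _ _ Ys Yt) hst.
  by apply: etrans (esym hs) (etrans _ ht); rewrite hst.
have h i : {t : T i | forall f, Y f -> f i <> t}.
  apply: cid; apply: contrapT => /forallNP nt; apply: nosurj; exists i => t.
  apply: contrapT => nf; apply: (nt t) => f Yf ft; apply: nf; by exists f.
pose f0 i := sval (h i).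
have nYf0 f i : Y f -> f i <> f0 i by exact: (svalP (h i)).
exfalso; apply: (maxY (Y `|` [set f0])).
  split; first by left.
  by move=> /(_ f0 (or_intror erefl)) Yf0; exact: (nYf0 _ i0 Yf0).
move=> i f g [Yf|->] [Yg|->] //.
- exact: PY.
- by move=> /(nYf0 _ _ Yf).
- by move=> /esym/(nYf0 _ _ Yg).
Qed.

Lemma card_le_total T U (A : set T) (B : set U) : A #<= B \/ B #<= A.
Proof.
have [i h] := ex_min_card true
  (fun b : bool => if b then set_type A else set_type B).
case: i h => h; have := h true; have := h false;
  rewrite !(card_le_eql (card_setT _)) !(card_le_eqr (card_setT _)).
  by left.
by right.
Qed.

Lemma is_least_card_ex (P : Type -> Prop) (L0 : Type) :
  (forall L M : Type, [set: L] #= [set: M] -> P L -> P M) -> P L0 ->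
  exists L, is_least_card P L.
Proof.
move=> Pinv PL0.
have PT : P (set_type [set: L0]) by apply: Pinv PL0; rewrite card_eq_sym.
pose J := {B : set L0 | P (set_type B)}.
have [[B PB] /= minB] :=
  ex_min_card (exist _ _ PT : J) (fun B => set_type (sval B)).
exists (set_type B); split=> // M PM.
have [LM|/card_subP[C CM _]] := card_le_total [set: L0] [set: M].
  apply: card_le_trans (minB (exist _ _ PT)) _.
  by rewrite /= (card_le_eql (card_setT _)).
have PC : P (set_type C).
  apply: Pinv PM; rewrite card_eq_sym; exact: card_eq_trans CM.
apply: card_le_trans (minB (exist _ _ PC)) _ => /=.
by rewrite (card_le_eql (card_setT _)); move: CM; rewrite card_eq_le => /andP[].
Qed.

Lemma least_cardP (P : Type -> Prop) :
  (exists L, is_least_card P L) -> is_least_card P (least_card P).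
Proof.
by rewrite /least_card; case: pselect => // exL _; exact: (projT2 (cid exL)).
Qed.

Lemma card_lt_set (A : Type) : A <c set A.
Proof.
split; first by apply/card_leTP; exists set1 => a b /seteqP[+ _]; exact.
move=> /card_leTP[f finj].
pose D := [set a | exists2 B, f B = a & ~ B a].
have [|nD] := pselect (D (f D)); last by apply: (nD); exists D.
by move=> /[dup] DfD [B /finj ->]; exact.
Qed.

Lemma succ_cardP (A : Type) : is_least_card (fun L => A <c L) (succ_card A).
Proof.
apply/least_cardP/(@is_least_card_ex _ (set A)); last exact: card_lt_set.
by move=> L M LM []; rewrite (card_le_eqr LM) (card_le_eql LM).
Qed.

Lemma infinite_double (A : Type) :
  infinite_set [set: A] -> (bool * A)%type <=c A.
Proof.
move=> /[dup] Ainf /infiniteP/card_leTP[e0 e0inj].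
pose D := [set f : nat -> A | injective f].
have [E [ED tE maxE]] := @ex_maximal_disjoint_subcollection _ _
  (fun f : nat -> A => range f) D.
pose F := ~` \bigcup_(f in E) range f.
have Ffin : finite_set F.
  apply: contrapT => /infiniteP; rewrite -(card_le_eqr (card_setT F)).
  move=> /card_leTP[g ginj]; pose g' n := val (g n).
  have Fg' n : F (g' n) by exact: set_valP.
  have nEg' : ~ E g' by move=> Eg'; apply: (Fg' 0); exists g' => //; exists 0.
  have disj f : E f -> range f `&` range g' = set0.
    move=> Ef; apply/seteqP; split=> // _ [[n _ <-] [m _ gf]].
    by apply: (Fg' m); exists f => //; exists n.
  apply: (maxE (E `|` [set g'])).
  - split; first by left.
    by move=> /(_ g' (or_intror erefl)).
  - by move=> f [/ED|->] // m n /val_inj/ginj.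
  - move=> f h [Ef|->] [Eh|->] // [x []].
    + by move=> xf xh; apply: tE => //; exists x.
    + by move=> xf xg; have : set0 x by rewrite -(disj f Ef).
    + by move=> xg xh; have : set0 x by rewrite -(disj h Eh).
have [r rinj] : exists r : set_type F -> nat, injective r.
  apply/card_leTP; rewrite (card_le_eql (card_setT F)).
  exact: finite_set_countable.
have [f0 Ef0] : E !=set0.
  apply/set0P/eqP => E0; apply: Ainf.
  by move: Ffin; rewrite /F E0 bigcup_set0 setC0.
pose S := {f | E f}.
have le1 : A <=c (S * (nat + nat))%type.
  apply/card_leTP.
  have h a : {p : S * (nat + nat) | match p.2 with
      | inl n => sval p.1 n = a | inr n => exists x, r x = n /\ val x = a end}.
    apply: cid; have [[f Ef [n _ fna]]|Fa] := pselect ((\bigcup_(f in E) range f) a).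
      by exists (exist _ f Ef, inl n).
    exists (exist _ f0 Ef0, inr (r (SigSub (mem_set (Fa : F a))))) => /=.
    by exists (SigSub (mem_set (Fa : F a))).
  exists (fun a => sval (h a)) => a b; move: (svalP (h a)) (svalP (h b)).
  move=> + + ab; rewrite ab; case: (sval (h b)) => f [n|n] /=; first by move=> <-.
  by move=> [x [<- <-]] [y [/rinj -> <-]].
have le2 : (bool * A)%type <=c (S * nat)%type.
  move/card_leTP: le1 => [g ginj]; apply/card_leTP.
  exists (fun p => ((g p.2).1, pickle (p.1, (g p.2).2))).
  move=> [b x] [c y] /= [gxy1 /(pcan_inj pickleK) [-> gxy2]].
  by congr (_, _); apply: ginj; case: (g x) (g y) gxy1 gxy2 => ? ? [? ?] /= -> ->.
apply: card_le_trans le2 _; apply/card_leTP.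
exists (fun p => sval p.1 p.2) => -[[f Ef] n] [[g Eg] m] /= fg.
have fgE : f = g by apply: tE => //; exists (f n); split; [exists n|exists m].
subst g; rewrite (ED _ Ef _ _ fg).
by congr (exist _ _ _, _); exact: Prop_irrelevance.
Qed.

Lemma card_lt_setU T (K : Type) (A B : set T) : infinite_set [set: K] ->
  A #< [set: K] -> B #< [set: K] -> A `|` B #< [set: K].
Proof.
move=> Kinf.
wlog BA : A B / B #<= A.
  move=> h ltA ltB; have [AB|BA] := card_le_total A B; last exact: h.
  by rewrite setUC; exact: h.
move=> [AK nKA] [BK nKB].
suff h : ~ ([set: K] #<= A `|` B).
  by split=> //; have [] := card_le_total (A `|` B) [set: K].
move=> KAB; have [Afin|Ainf] := pselect (finite_set A).
  apply: Kinf; apply: card_le_finite KAB _; rewrite finite_setU; split => //.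
  exact: card_le_finite BA Afin.
apply: nKA; apply: card_le_trans KAB _.
move: BA; rewrite -(card_le_eql (card_setT B)) -(card_le_eqr (card_setT A)).
move=> /card_leTP[f finj].
have Ainf' : infinite_set [set: set_type A].
  by apply/infiniteP; rewrite (card_le_eqr (card_setT A)); apply/infiniteP.
rewrite -(card_le_eqr (card_setT A)).
apply: card_le_trans (infinite_double Ainf').
rewrite -(card_le_eql (card_setT (A `|` B))); apply/card_leTP.
have h (x : set_type (A `|` B)) : {p : bool * set_type A |
    if p.1 then val p.2 = val x else exists2 y, f y = p.2 & val y = val x}.
  apply: cid; have [Ax|Bx] := set_valP x.
    by exists (true, SigSub (mem_set Ax)).
  by exists (false, f (SigSub (mem_set Bx))); exists (SigSub (mem_set Bx)).
exists (fun x => sval (h x)) => x y xy; apply: val_inj.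
move: (svalP (h x)) (svalP (h y)); rewrite xy.
case: (sval (h y)) => [[] a] /= => [<- //|].
by move=> [u + <-] [v + <-] => <- /finj ->.
Qed.

End ZornCardinals.

Definition cellular (X : topologicalType) (C : set (set X)) : Prop :=
  [/\ C `<=` open, (forall U, C U -> U !=set0) & trivIset C id].

Definition souslin (X : topologicalType) : Type :=
  least_card (fun L => ~ exists2 C : set (set X), cellular C & C #= [set: L]).

Lemma souslinP (X : topologicalType) :
  is_least_card
    (fun L => ~ exists2 C : set (set X), cellular C & C #= [set: L])
    (souslin X).
Proof.
apply/least_cardP/(@is_least_card_ex _ (set (set X))).
  move=> L M LM nL [C cC CM]; apply: nL; exists C => //.
  by rewrite (card_eqr LM).
move=> [C _]; rewrite card_eq_sym card_eq_le => /andP[le _].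
have [_] := card_lt_set (set X); apply; exact: card_le_trans le (card_leT _).
Qed.

Definition is_box (K I : Type) (X : I -> topologicalType) :
    set (set (forall i, X i)) :=
  [set B | exists U : forall i, set (X i), [/\ forall i, open (U i),
     [set i | U i <> setT] #< [set: K] &
     B = [set f | forall i, U i (f i)]]].
Arguments is_box : clear implicits.

(** The product of the [X i] with the [K]-box topology. Infiniteness of [K] is
    what makes the boxes a base; it is kept as a parameter of the type. *)
Definition box_prod (K : Type) (Kinf : infinite_set [set: K]) (I : Type)
  (X : I -> topologicalType) : Type := forall i, X i.

Section BoxTopology.
Variables (K : Type) (Kinf : infinite_set [set: K]) (I : Type).
Variable X : I -> topologicalType.

HB.instance Definition _ := Choice.copy (box_prod Kinf X) (forall i, X i).

Let box_cover : \bigcup_(B in is_box K I X) B = [set: box_prod Kinf X].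
Proof.
apply/seteqP; split=> // f _; exists setT => //.
exists (fun=> setT); split; [by move=> i; exact: openT| |exact/seteqP].
have -> : [set i : I | [set: X i] <> setT] = set0.
  by apply/seteqP; split=> // i; apply.
split; first exact: card_ge0.
by rewrite card_le0 => /eqP K0; apply: Kinf; rewrite K0.
Qed.

Let box_join (A B : set (box_prod Kinf X)) (f : box_prod Kinf X) :
  is_box K I X A -> is_box K I X B -> A f -> B f ->
  exists C, [/\ is_box K I X C, C f & C `<=` A `&` B].
Proof.
move=> [U [oU UK ->]] [V [oV VK ->]] Uf Vf.
exists [set g | forall i, (U i `&` V i) (g i)]; split=> //; last first.
  by move=> g UVg; split=> i; have [] := UVg i.
exists (fun i => U i `&` V i); split=> //; first by move=> i; exact: openI.
have UVK := card_lt_setU Kinf UK VK.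
have sub : [set i | U i `&` V i <> setT] `<=`
    [set i | U i <> setT] `|` [set i | V i <> setT].
  move=> i /= UVi; apply: contrapT => /not_orP[/contrapT Ui /contrapT Vi].
  by apply: UVi; rewrite Ui Vi setTI.
split; first by apply: card_le_trans (subset_card_le sub) _; case: UVK.
by move=> h; case: UVK => _; apply; apply: card_le_trans h (subset_card_le sub).
Qed.

HB.instance Definition _ := isBaseTopological.Build (box_prod Kinf X)
  box_cover box_join.

End BoxTopology.

(** The open sets are exactly the unions of boxes. *)
Lemma open_box_prod (K : Type) (Kinf : infinite_set [set: K]) (I : Type)
    (X : I -> topologicalType) (A : set (box_prod Kinf X)) :
  open A <-> exists2 D, D `<=` is_box K I X & \bigcup_(B in D) B = A.
Proof. by []. Qed.

(* Main.v *)
(** Upper bounds: among pairwise disjoint boxes [U j], colour a pair [(j, k)] by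
    a coordinate of the support of [j] where [U j] and [U k] are disjoint. If
    there are too many boxes, an Erdos-Rado argument yields a long sequence of
    boxes and one further box [t] such that each box is separated from all later
    ones at the coordinate where it is separated from [t]. These coordinates lie
    in the small support of [t], so one of them occurs often, and that factor
    has a cellular family which is too large.

    Lower bounds: prescribing on few coordinates the members of cellular families
    of the factors gives disjoint boxes as soon as any two prescriptions differ
    at a common coordinate. *)
Require Import Defs.
From Stdlib Require Inverse_Image.
From mathcomp Require Import all_boot.
From mathcomp Require Import boolp classical_sets functions cardinality.
From mathcomp Require Import wochoice topology_structure.

Set Implicit Arguments.
Unset Strict Implicit.
Unset Printing Implicit Defensive.

Local Open Scope classical_set_scope.
Local Open Scope card_scope.

(** * Strict comparison of cardinals and successor cardinals *)

Lemma card_leTlt_trans T U V (A : set T) (B : set U) (C : set V) :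
  A #<= B -> B #< C -> A #< C.
Proof.
move=> AB [BC nCB]; split; first exact: card_le_trans BC.
by move=> CA; apply: nCB; exact: card_le_trans AB.
Qed.

Lemma card_ltTle_trans T U V (A : set T) (B : set U) (C : set V) :
  A #< B -> B #<= C -> A #< C.
Proof.
move=> [AB nBA] BC; split; first exact: card_le_trans BC.
by move=> CA; apply: nBA; exact: card_le_trans CA.
Qed.

Lemma card_ltNge T U (A : set T) (B : set U) : A #< B <-> ~ (B #<= A).
Proof. by split=> [[]//|nBA]; split=> //; have [] := card_le_total A B. Qed.

Lemma card_leNlt T U (A : set T) (B : set U) : A #<= B <-> ~ (B #< A).
Proof. by split=> [AB []//|/card_ltNge/contrapT]. Qed.

Lemma card_lt_setT T U (A : set T) (B : set U) :
  [set: set_type A] #< B <-> A #< B.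
Proof.
by rewrite /card_lt (card_le_eql (card_setT A)) (card_le_eqr (card_setT A)).
Qed.

Lemma card_le_setT T U (A : set T) (B : set U) :
  [set: set_type A] #<= B <-> A #<= B.
Proof. by rewrite (card_le_eql (card_setT A)). Qed.

Lemma card_le_set_typeP T U (A : set T) :
  A #<= [set: U] <-> exists f : set_type A -> U, injective f.
Proof. by rewrite -card_leTP -(card_le_eql (card_setT A)). Qed.

Lemma succ_card_lt (A : Type) : A <c succ_card A.
Proof. by have [] := succ_cardP A. Qed.

Lemma succ_card_le (A L : Type) : A <c L -> succ_card A <=c L.
Proof. by have [_] := succ_cardP A; exact. Qed.

Lemma lt_succ_card (A L : Type) : L <c succ_card A -> L <=c A.
Proof. by move=> LA; apply/card_leNlt => /succ_card_le /card_leNlt; exact. Qed.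

Lemma succ_card_le_fun (A : Type) : succ_card A <=c (A -> bool).
Proof.
apply: succ_card_le; apply: (card_ltTle_trans (card_lt_set A)).
apply/card_leTP; exists (fun B a => `[< B a >]) => B C BC.
apply/seteqP; split=> a; move: (congr1 (@^~ a) BC) => /= BCa.
  by move=> /asboolP; rewrite BCa => /asboolP.
by move=> /asboolP; rewrite -BCa => /asboolP.
Qed.

(** * Well-founded recursion and initial well-orders *)

Lemma wf_rec (P B : Type) (R : P -> P -> Prop)
    (F : forall p, (set_type [set q | R q p] -> B) -> B) :
  well_founded R -> exists f : P -> B, forall p, f p = F p (fun q => f (val q)).
Proof.
move=> Rwf.
pose G p (g : forall q, R q p -> B) := F p (fun q => g (val q) (set_valP q)).
exists (Fix Rwf (fun=> B) G) => p; rewrite Fix_eq // => {}p g h gh.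
by congr (F p _); apply/funext => q; exact: gh.
Qed.

(* A map sending each point outside the image of its initial segment is
   injective. *)
Lemma wf_total_card_le (P K : Type) (R : P -> P -> Prop) :
  well_founded R -> (forall p q, R p q \/ p = q \/ R q p) ->
  (forall p, [set q | R q p] #< [set: K]) -> P <=c K.
Proof.
move=> Rwf Rtot seglt.
have new p (g : set_type [set q | R q p] -> K) : {k | forall q, g q <> k}.
  apply: cid; apply: contrapT => nk.
  have [_] := (card_lt_setT _ _).2 (seglt p); apply.
  have h k : {q | g q = k}.
    apply: cid; apply: contrapT => nq; apply: nk; exists k => q gq.
    by apply: nq; exists q.
  apply/card_leTP; exists (fun k => sval (h k)) => k l kl.
  by rewrite -(svalP (h k)) kl (svalP (h l)).
have [f fE] := wf_rec (fun p g => sval (new p g)) Rwf.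
have fneq p q : R q p -> f q <> f p.
  move=> Rqp; rewrite (fE p).
  exact: (svalP (new p (fun q => f (val q)))
    (SigSub (mem_set (Rqp : [set q | R q p] q)))).
apply/card_leTP; exists f => p q fpq.
by have [/fneq|[//|/fneq]] := Rtot p q; rewrite fpq.
Qed.

(** Order isomorphic to the initial ordinal of the cardinal of [K]. *)
Definition initial_wo (K : Type) (lt : K -> K -> Prop) : Prop :=
  [/\ well_founded lt, (forall x y, lt x y \/ x = y \/ lt y x),
      (forall x y z, lt x y -> lt y z -> lt x z) &
      forall x, [set y | lt y x] #< [set: K]].

Lemma wf_irrefl (K : Type) (lt : K -> K -> Prop) :
  well_founded lt -> forall x, ~ lt x x.
Proof. by move=> wf x; elim: (wf x) => y _ IH yy; exact: (IH _ yy yy). Qed.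

Lemma wf_min (K : Type) (lt : K -> K -> Prop) (P : K -> Prop) :
  well_founded lt -> (exists x, P x) ->
  exists2 x, P x & forall y, lt y x -> ~ P y.
Proof.
move=> wf [x Px]; apply: contrapT => nmin.
elim: (wf x) Px => y _ IH Py; apply: nmin; exists y => // z zy Pz.
Qed.

(* If some initial segment of a well-order is as large as [K], pull the order
   back along an embedding of [K] into the least such segment. *)
Lemma ex_initial_wo (K : Type) : exists lt : K -> K -> Prop, initial_wo lt.
Proof.
have [R Rwo] := well_ordering_principle {classic K}.
have Rtot x y : R x y || R y x.
  have [|z [[zA zmin] _]] := Rwo (pred2 x y).
    by exists x; rewrite inE eqxx.
  move: zA; rewrite inE => /orP[] /eqP zE; rewrite -zE.
    by rewrite zmin ?inE ?eqxx ?orbT.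
  by rewrite orbC zmin ?inE ?eqxx.
have Ranti x y : R x y -> R y x -> x = y.
  move=> Rxy Ryx; have [|z [_ zuniq]] := Rwo (pred2 x y).
    by exists x; rewrite inE eqxx.
  have Rr u : R u u by have := Rtot u u; rewrite orbb.
  have zx : z = x by apply: zuniq; split=> [|u]; rewrite inE ?eqxx // => /orP[] /eqP ->.
  rewrite -zx; apply: zuniq.
  by split=> [|u]; rewrite inE ?eqxx ?orbT // => /orP[] /eqP ->.
pose lt x y := R x y /\ x <> y.
have lttot x y : lt x y \/ x = y \/ lt y x.
  have [->|xy] := pselect (x = y); first by right; left.
  have /orP[Rxy|Ryx] := Rtot x y; [by left|right; right].
  by split=> // /esym.
have ltwf : well_founded lt.
  move=> x; apply: contrapT => nAx.
  have [|z [[/asboolP nAz zmin] _]] := Rwo (fun u => `[< ~ Acc lt u >]).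
    by exists x; apply/asboolP.
  apply: nAz; constructor => y [Ryz yz]; apply: contrapT => nAy.
  by apply: yz; apply: Ranti => //; apply: zmin; apply/asboolP.
have lttr x y z : lt x y -> lt y z -> lt x z.
  move=> xy yz; have [//|h] := lttot x z; exfalso.
  (* Otherwise [x], [y], [z] form a cycle, and their least element has a predecessor among them. *)
  have [u [Pu Mu]] : exists u, (u = x \/ u = y \/ u = z) /\
      forall v, lt v u -> ~ (v = x \/ v = y \/ v = z).
    have [|u Pu Mu] := @wf_min _ _ (fun u => u = x \/ u = y \/ u = z) ltwf.
      by exists x; left.
    by exists u.
  case: Pu => [ux|[uy|uz]].
  - case: h => [xz|zx]; last by apply: (Mu z); rewrite ?ux; tauto.
    by apply: (Mu y); rewrite ?ux ?xz; tauto.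
  - by apply: (Mu x); rewrite ?uy; tauto.
  - by apply: (Mu y); rewrite ?uz; tauto.
have [seglt|] := pselect (forall x, [set y | lt y x] #< [set: K]).
  by exists lt.
move=> /existsNP exw.
have [w Kw minw] := wf_min ltwf exw.
have {}Kw : [set: K] #<= [set y | lt y w] by move/card_ltNge/contrapT : Kw.
move: (Kw); rewrite -(card_le_eqr (card_setT _)) => /card_leTP[g ginj].
exists (fun x y => lt (val (g x)) (val (g y))); split.
- by apply: Inverse_Image.wf_inverse_image ltwf.
- move=> x y; have [|[/val_inj/ginj|]] := lttot (val (g x)) (val (g y)); tauto.
- by move=> x y z; exact: lttr.
- move=> x; have /contrapT := minw _ (set_valP (g x)).
  apply: card_leTlt_trans; rewrite -card_le_setT.
  rewrite -(card_le_eqr (card_setT _)); apply/card_leTP.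
  exists (fun y => SigSub (mem_set (set_valP y :
    [set z | lt z (val (g x))] (val (g (val y)))))).
  by move=> y z /(congr1 val) /= /val_inj/ginj/val_inj.
Qed.

(** * Arithmetic of infinite cardinals: squares, sums and powers *)

Lemma infinite_set_le T U (A : set T) (B : set U) :
  infinite_set A -> A #<= B -> infinite_set B.
Proof. by move=> + AB; apply: contra_not; exact: card_le_finite. Qed.

Lemma finite_set_lt T U (A : set T) (B : set U) :
  finite_set A -> infinite_set B -> A #< B.
Proof. by move=> Afin Binf; apply/card_ltNge => /(infinite_set_le Binf). Qed.

Lemma card_le_prod (A B A' B' : Type) :
  A <=c A' -> B <=c B' -> (A * B)%type <=c (A' * B')%type.
Proof.
move=> /card_leTP[f finj] /card_leTP[g ginj]; apply/card_leTP.
by exists (fun p => (f p.1, g p.2)) => -[a b] [c d] [/finj eac /ginj ebd]; rewrite eac ebd.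
Qed.

Lemma card_le_setX T U (A : set T) (B : set U) :
  A `*` B #<= [set: set_type A * set_type B].
Proof.
apply/card_le_set_typeP.
exists (fun p : set_type (A `*` B) => (SigSub (mem_set (set_valP p).1) : set_type A,
                  SigSub (mem_set (set_valP p).2) : set_type B)).
by move=> [[a b] p] [[c d] q] [/= ac bd]; apply: val_inj; rewrite /= ac bd.
Qed.

Lemma finite_prod (A B : Type) : finite_set [set: A] -> finite_set [set: B] ->
  finite_set [set: A * B].
Proof. by move=> Afin Bfin; rewrite -setXTT; exact: finite_setX. Qed.

(* Hessenberg: in a least counterexample [B], well-ordered initially, order
   [B * B] by maximum first; its initial segments lie in squares of proper
   initial segments of [B]. *)
Lemma infinite_square (A : Type) :
  infinite_set [set: A] -> (A * A)%type <=c A.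
Proof.
move=> Ainf; apply: contrapT => nAA.
pose P L := infinite_set [set: L] /\ ~ ((L * L)%type <=c L).
have [|B [[Binf nBB] minB]] := @is_least_card_ex P A _ (conj Ainf nAA).
  move=> L M; rewrite card_eq_le => /andP[LM ML] [Linf nLL]; split.
    exact: infinite_set_le LM.
  move=> MM; apply: nLL; apply: card_le_trans ML.
  by apply: card_le_trans MM; exact: card_le_prod.
apply: nBB; have [lt [ltwf lttot lttr ltseg]] := ex_initial_wo B.
pose le x y := x = y \/ lt x y.
pose mx x y := if `[< lt x y >] then y else x.
have le_mxl x y : le x (mx x y).
  by rewrite /mx; case: asboolP => xy; [right|left].
have le_mxr x y : le y (mx x y).
  rewrite /mx; case: asboolP => [xy|nxy]; first by left.
  by have [|[->|]] := lttot x y => //; [left|right].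
pose R p q := lt (mx p.1 p.2) (mx q.1 q.2) \/
  (mx p.1 p.2 = mx q.1 q.2 /\ (lt p.1 q.1 \/ (p.1 = q.1 /\ lt p.2 q.2))).
apply: (@wf_total_card_le _ _ R).
(* Nested induction: on the maximum, then on the first and the second coordinate. *)
- suff h m x y : mx x y = m -> Acc R (x, y) by move=> [x y]; exact: (h _ _ _ erefl).
  elim: (ltwf m) x y => {}m _ IHm x; elim: (ltwf x) => {}x _ IHx y.
  elim: (ltwf y) => {}y _ IHy xym; constructor => -[u v]; rewrite /R /= xym.
  move=> [uv|[uv [ux|[ux vy]]]]; first exact: IHm uv _ _ erefl.
    exact: IHx.
  by subst u; exact: IHy.
- move=> [x y] [u v]; rewrite /R /=.
  have [?|[->|?]] := lttot (mx x y) (mx u v); [tauto| |tauto].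
  have [?|[->|?]] := lttot x u; [tauto| |tauto].
  have [?|[->|?]] := lttot y v; tauto.
move=> [x y]; set m := mx x y.
(* Both coordinates of every [R]-predecessor of [(x, y)] lie in this closed segment. *)
pose D := [set z | lt z m] `|` [set m].
have ltD : D #< [set: B].
  by apply: card_lt_setU => //; exact: finite_set_lt (finite_set1 m) Binf.
apply: (@card_leTlt_trans _ _ _ _ (D `*` D)).
  apply: subset_card_le => -[u v]; rewrite /R /= -/m => Ruv.
  have leD z : le z (mx u v) -> D z.
    rewrite /D /le /= => zm.
    have muv : mx u v = m \/ lt (mx u v) m by tauto.
    case: zm => [->|zm]; first by tauto.
    by case: muv => [<-|muv]; left => //; exact: lttr zm muv.
  by split; apply: leD.
have [Dfin|Dinf] := pselect (finite_set D).
  by apply: finite_set_lt => //; exact: finite_setX.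
have nP : ~ P (set_type D).
  by move=> /minB; rewrite (card_le_eqr (card_setT D)); case: ltD.
apply: card_leTlt_trans ltD.
have : (set_type D * set_type D)%type <=c set_type D.
  apply: contrapT => nDD; apply: nP; split=> //.
  by apply: infinite_set_le Dinf _; rewrite (card_le_eqr (card_setT D)).
rewrite (card_le_eqr (card_setT D)); apply: card_le_trans; exact: card_le_setX.
Qed.

Lemma card_le_prod_infinite (A B C : Type) : infinite_set [set: C] ->
  A <=c C -> B <=c C -> (A * B)%type <=c C.
Proof.
move=> Cinf AC BC; apply: card_le_trans (infinite_square Cinf).
exact: card_le_prod.
Qed.

Lemma card_lt_prod (A B C : Type) : infinite_set [set: C] ->
  A <c C -> B <c C -> (A * B)%type <c C.
Proof.
have main (D E : Type) : infinite_set [set: C] -> D <=c E -> E <c C ->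
    (D * E)%type <c C.
  move=> Cinf DE EC; have [Efin|Einf] := pselect (finite_set [set: E]).
    apply: finite_set_lt => //; apply: finite_prod => //.
    exact: card_le_finite DE Efin.
  by apply: card_leTlt_trans EC; exact: card_le_prod_infinite.
move=> Cinf AC BC; have [AB|BA] := card_le_total [set: A] [set: B].
  exact: main.
apply: card_leTlt_trans (main _ _ Cinf BA AC).
by apply/card_leTP; exists (fun p => (p.2, p.1)) => -[? ?] [? ?] [-> ->].
Qed.

Lemma card_le_sigT (A C : Type) (B : A -> Type) : (forall a, B a <=c C) ->
  {a & B a} <=c (A * C)%type.
Proof.
move=> BC; have h a : {f : B a -> C | injective f}.
  by apply: cid; apply/card_leTP.
apply/card_leTP; exists (fun p => (projT1 p, sval (h (projT1 p)) (projT2 p))).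
by move=> [a b] [c d] /= [ac]; subst c => /(svalP (h a)) ->.
Qed.

Lemma card_le_sigT_infinite (A C : Type) (B : A -> Type) :
  infinite_set [set: C] -> A <=c C -> (forall a, B a <=c C) ->
  {a & B a} <=c C.
Proof.
move=> Cinf AC BC; apply: card_le_trans (card_le_sigT BC) _.
exact: card_le_prod_infinite.
Qed.

Lemma card_le_fun_codom (L A B : Type) : A <=c B -> (L -> A) <=c (L -> B).
Proof.
move=> /card_leTP[f finj]; apply/card_leTP; exists (fun g l => f (g l)) => g h gh.
by apply/funext => l; apply: finj; exact: (congr1 (@^~ l) gh).
Qed.

Lemma card_le_fun_dom (L M A : Type) (a : A) :
  L <=c M -> (L -> A) <=c (M -> A).
Proof.
move=> /card_leTP[f finj].
pose F (g : L -> A) m := if pselect (exists l, f l = m) is left e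
  then g (sval (cid e)) else a.
have FE g l : F g (f l) = g l.
  rewrite /F; case: pselect => [e|[]]; last by exists l.
  by congr g; apply: finj; exact: (svalP (cid e)).
by apply/card_leTP; exists F => g h gh; apply/funext => l; rewrite -!FE gh.
Qed.

Lemma card_le_curry (L M A : Type) : (L -> M -> A) <=c ((L * M)%type -> A).
Proof.
apply/card_leTP; exists (fun g p => g p.1 p.2) => g h gh.
by apply/funext => l; apply/funext => m; exact: (congr1 (@^~ (l, m)) gh).
Qed.

(** * Cardinals below [K] and weak powers *)

Lemma lt_card_segment (K L : Type) (lt : K -> K -> Prop) :
  initial_wo lt -> L <c K -> exists w, [set: L] #= [set v | lt v w].
Proof.
move=> [ltwf lttot lttr _] LK.
(* The segment of [w] is the least one as large as [L]; the segments inside it are smaller than [L],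
   which gives the reverse inequality. *)
have [w Lw minw] : exists2 w, [set: L] #<= [set v | lt v w] &
    forall u, lt u w -> ~ ([set: L] #<= [set v | lt v u]).
  apply: wf_min => //; apply: contrapT => /forallNP nL.
  have [_] := LK; apply; apply: wf_total_card_le ltwf lttot _ => w.
  exact/card_ltNge/nL.
exists w; rewrite card_eq_le Lw /= -card_le_setT.
apply: (@wf_total_card_le _ _ (fun x y => lt (val x) (val y))).
- by apply: Inverse_Image.wf_inverse_image ltwf.
- move=> x y; have [|[/val_inj|]] := lttot (val x) (val y); tauto.
move=> x; have /card_ltNge := minw _ (set_valP x).
apply: card_leTlt_trans; rewrite -card_le_setT -(card_le_eqr (card_setT _)).
apply/card_leTP.
exists (fun y => SigSub (mem_set (set_valP y : [set z | lt z (val x)] (val (val y))))).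
by move=> y z /(congr1 val) /= /val_inj/val_inj.
Qed.

(** Each cardinal below [K] is that of a segment of an initial well-order, so the endpoint
    determines it; equipotent members are equal because [card_rep] fixes both. *)
Lemma cards_below_le (K : Type) : set_type (cards_below K) <=c K.
Proof.
have [lt ltwo] := ex_initial_wo K.
have h (L : set_type (cards_below K)) : {w | val L #= [set v | lt v w]}.
  apply: cid; have [LK _] := set_valP L.
  have [|w] := lt_card_segment (L := set_type (val L)) ltwo; first exact/card_lt_setT.
  by rewrite (card_eql (card_setT _)); exists w.
apply/card_leTP; exists (fun L => sval (h L)) => L M LM; apply: val_inj.
have [[_ <-] [_ <-]] := (set_valP L, set_valP M).
have LeM : val L #= val M.
  by rewrite (card_eql (svalP (h L))) LM card_eq_sym; exact: svalP (h M).
rewrite /card_rep; congr (xget _ _); apply/seteqP.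
by split=> N /= NL; [rewrite -(card_eqr LeM)|rewrite (card_eqr LeM)].
Qed.

Lemma cards_below_ex (K L : Type) : L <c K ->
  exists M : set_type (cards_below K), [set: set_type (val M)] #= [set: L].
Proof.
move=> [LK nKL]; have /card_subP[N LN _] := LK.
have repN : card_rep N #= N.
  by rewrite /card_rep; apply: (@xgetPex _ set0 [set M | M #= N]); exists N; exact: card_eqxx.
have repL : card_rep N #= [set: L] by rewrite (card_eql repN).
have below : cards_below K (card_rep N).
  split.
    by rewrite /card_lt (card_le_eql repL) (card_le_eqr repL).
  rewrite [in LHS]/card_rep; congr (xget _ _); apply/seteqP.
  by split=> M /= MN; [rewrite -(card_eqr repN)|rewrite (card_eqr repN)].
by exists (SigSub (mem_set below)); rewrite (card_eql (card_setT _)).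
Qed.

(** Equipotence replaces the default value of [card_le_fun_dom], so [A] may be empty: [h] inverts
    [f] on its image and follows [g] elsewhere. *)
Lemma card_eq_fun_dom (L M A : Type) : [set: L] #= [set: M] ->
  (L -> A) <=c (M -> A).
Proof.
rewrite card_eq_le => /andP[/card_leTP[f finj] /card_leTP[g ginj]].
have h m : {l | forall l', f l' = m -> l = l'}.
  apply: cid; have [[l fl]|nl] := pselect (exists l, f l = m).
    by exists l => l' fl'; apply: finj; rewrite fl.
  by exists (g m) => l' fl'; case: nl; exists l'.
apply/card_leTP; exists (fun u m => u (sval (h m))) => u v uv.
apply/funext => l; have := congr1 (@^~ (f l)) uv => /=.
by rewrite (svalP (h (f l)) l).
Qed.

(** Transport along a proof of [i = i] is trivial by proof irrelevance. *)
Lemma existT_inj (I : Type) (F : I -> Type) (i : I) : injective (existT F i).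
Proof.
move=> u v uv.
suff h p : p = existT F i u -> forall e : projT1 p = i,
    eq_rect _ F (projT2 p) _ e = u by exact: (esym (h _ (esym uv) erefl)).
by move=> -> e; rewrite (Prop_irrelevance e erefl).
Qed.

Lemma fun_le_wpow (A K L : Type) : L <c K -> (L -> A) <=c wpow A K.
Proof.
move=> /cards_below_ex[M]; rewrite card_eq_sym => /card_eq_fun_dom LM.
apply: card_le_trans (LM A) _; apply/card_leTP.
by exists (existT _ M); exact: existT_inj.
Qed.

Lemma wpow_le (A K S : Type) : infinite_set [set: S] ->
  set_type (cards_below K) <=c S -> (forall L, L <c K -> (L -> A) <=c S) ->
  wpow A K <=c S.
Proof.
move=> Sinf KS LS; apply: card_le_sigT_infinite => // L.
by apply: LS; apply/card_lt_setT; case: (set_valP L).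
Qed.

(** * End-homogeneous sequences *)

(* Each [t] follows the greedy sequence of points which relate to their
   predecessors as [t] does; if [t] is ever picked, the colours met on the way
   determine it. *)
Lemma end_homogeneous (W T Col : Type) (lt : W -> W -> Prop) (c : T -> T -> Col) :
  well_founded lt -> (forall x y z, lt x y -> lt y z -> lt x z) ->
  T <=c {w & set_type [set v | lt v w] -> Col} \/
  exists t (f : W -> T), [/\ forall v w, lt v w -> f v <> f w,
    forall v w, lt v w -> c (f v) (f w) = c (f v) t & forall v, f v <> t].
Proof.
move=> ltwf lttr; have [[t0]|noT] := pselect (inhabited T); last first.
  left; apply/card_leTP.
  by exists (fun t => match noT (inhabits t) with end) => t; case: (noT (inhabits t)).
(* Candidates for place [w]: points other than the earlier values, with the same colours as [t] from
   these. *)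
pose next t w (g : set_type [set v | lt v w] -> T) : set {classic T} :=
  [set x | forall v, g v <> x /\ c (g v) x = c (g v) t].
have h t := wf_rec (fun w g => xget (t0 : {classic T}) (@next t w g)) ltwf.
pose f t := sval (cid (h t)).
pose N t w := next t w (fun v => f t (val v)).
have fE t w : f t w = xget (t0 : {classic T}) (N t w) by exact: (svalP (cid (h t))).
(* As long as [t] has not been picked, [t] itself is a candidate. *)
have nextP t w : (forall v, lt v w -> f t v <> t) -> N t w (f t w).
  move=> ft; rewrite fE; apply: (@xgetPex _ (t0 : {classic T}) (N t w)).
  by exists t => v; split=> //; apply: ft; exact: (set_valP v).
have [[t ft]|exw] := pselect (exists t, forall w, f t w <> t).
  right; exists t, (f t); split=> // v w vw;
    by have [] := @nextP t w (fun v _ => ft v)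
      (SigSub (mem_set (vw : [set v | lt v w] v))).
have hit t : {w | f t w = t}.
  apply: cid; apply: contrapT => nw; apply: exw; exists t => w ftw.
  by apply: nw; exists w.
left; apply/card_leTP.
(* The code of [t] is the place where it is picked and its colours from the earlier points. *)
exists (fun t => existT (fun w => set_type [set v | lt v w] -> Col) (sval (hit t))
  (fun v => c (f t (val v)) t)) => s t.
move: (svalP (hit s)) (svalP (hit t)); move: (sval (hit s)) (sval (hit t)).
move=> w w' fs ft cst; have /= ww' := congr1 (@projT1 _ _) cst; subst w'.
have {}cst := existT_inj cst; rewrite -fs -ft.
suff : forall v, v = w \/ lt v w -> f s v = f t v by apply; left.
(* Equal codes give, by induction up to [w], equal candidate sets and hence equal choices. *)
move=> v; elim: (ltwf v) => {}v _ IHv vw; rewrite !fE; suff -> : N s v = N t v by [].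

have xw x : lt x v -> [set v | lt v w] x by case: vw => [->//|/[swap]]; exact: lttr.
apply/seteqP; split=> x Nx u; have /= uv := set_valP u; have [] := Nx u;
  have := congr1 (@^~ (SigSub (mem_set (xw _ uv)))) cst => /=;
  by rewrite (IHv _ uv (or_intror (xw _ uv))) => cstu nfu fux; split=> //; rewrite fux.
Qed.

(** * Souslin numbers and the upper bound for box products *)

Lemma souslin_gtP (X : topologicalType) (J : Type) :
  J <c souslin X <-> exists V : J -> set X, [/\ forall j, open (V j),
    forall j, V j !=set0 & forall j k, j <> k -> V j `&` V k = set0].
Proof.
have [noC leastC] := souslinP X; split=> [JX|[V [Vopen V0 Vdisj]]].
  have [C [Copen C0 Cdisj]] : exists2 C : set (set X), cellular C & C #= [set: J].
    by apply: contrapT => /leastC /card_leNlt.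
  rewrite card_eq_sym card_eq_le => /andP[].
  rewrite -(card_le_eqr (card_setT C)) => /card_leTP[f finj] _.
  exists (fun j => val (f j)); split.
  - by move=> j; apply: Copen; exact: set_valP.
  - by move=> j; apply: C0; exact: set_valP.
  - move=> j k jk; apply: contrapT => /eqP/set0P fjk; apply: jk; apply: finj.
    by apply: val_inj; apply: Cdisj => //; exact: set_valP.
(* Restricting the family along [g] would give a cellular family of the forbidden cardinality
   [souslin X]. *)
apply/card_ltNge => /card_leTP[g ginj]; apply: noC.
exists (range (V \o g)).
  split.
  - by move=> _ [s _ <-]; exact: Vopen.
  - by move=> _ [s _ <-]; exact: V0.
  - move=> _ _ [s _ <-] [t _ <-] /= VV; have [->//|st] := pselect (s = t).
    by case: VV => x; rewrite Vdisj // => /ginj.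
apply: inj_card_eq => s t _ _ /= Vst; apply: contrapT => st.
have [x Vx] := V0 (g s).
suff : set0 x by []; rewrite -(Vdisj (g s) (g t)); last by move=> /ginj.
by split=> //; rewrite -Vst.
Qed.

Lemma souslin_le_succ (X : topologicalType) (N : Type) :
  (forall J : Type, J <c souslin X -> J <=c N) -> souslin X <=c succ_card N.
Proof.
move=> XN; apply/card_leNlt => /XN /card_leNlt; apply; exact: succ_card_lt.
Qed.

Lemma box_family_lt_souslin (K I J : Type) (Kinf : infinite_set [set: K])
    (X : I -> topologicalType) (U : J -> forall i, set (X i)) :
  (forall j i, open (U j i)) -> (forall j i, U j i !=set0) ->
  (forall j, [set i | U j i <> setT] #< [set: K]) ->
  (forall j k, j <> k -> exists i, U j i `&` U k i = set0) ->
  J <c souslin (box_prod Kinf X).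
Proof.
move=> Uopen U0 Usupp Udisj; apply/souslin_gtP.
exists (fun j => [set f : box_prod Kinf X | forall i, U j i (f i)]); split.
- move=> j; apply/open_box_prod; exists [set [set f | forall i, U j i (f i)]].
    by move=> _ ->; exists (U j).
  by rewrite bigcup_set1.
- by move=> j; exists (fun i => sval (cid (U0 j i))) => i; exact: (svalP (cid (U0 j i))).
move=> j k /Udisj[i Ui]; apply/seteqP; split=> // f [fj fk].
by have : set0 (f i) by rewrite -Ui; split.
Qed.

(** [M] supplies both the length of the sequence and the colours; it is [succ_card A] in the first
    case of the theorem and [K] in the second. *)
Lemma box_prod_cellular_le (A K M I : Type) (Kinf : infinite_set [set: K])
    (lt : M -> M -> Prop) (X : I -> topologicalType) :
  initial_wo lt -> infinite_set [set: M] -> K <=c M -> A <c M ->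
  (forall i (J : Type), J <c souslin (X i) -> J <=c A) ->
  forall J : Type, J <c souslin (box_prod Kinf X) ->
    J <=c {w & set_type [set v | lt v w] -> M}.
Proof.
move=> [ltwf lttot lttr _] Minf KM AM XA J /souslin_gtP[V [Vopen V0 Vdisj]].
have boxV j : {U : forall i, set (X i) | [/\ forall i, open (U i),
    [set i | U i <> setT] #< [set: M], (forall i, U i !=set0) &
    forall f : box_prod Kinf X, (forall i, U i (f i)) -> V j f]}.
  apply: cid; have [f Vf] := V0 j; have [D Dbox DV] := (open_box_prod _).1 (Vopen j).
  move: (Vf); rewrite -DV => -[B DB Bf]; have [U [Uopen Usupp BU]] := Dbox _ DB.
  rewrite BU in Bf; exists U; split=> //.
  - exact: card_ltTle_trans KM.
  - by move=> i; exists (f i); exact: Bf.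
  - by move=> g Ug; exists B => //; rewrite BU.
pose U j := sval (boxV j); pose supp j := [set i | U j i <> setT].
have Uopen j i : open (U j i) by have [] := svalP (boxV j).
have U0 j i : U j i !=set0 by have [] := svalP (boxV j).
have Usupp j : supp j #< [set: M] by have [] := svalP (boxV j).
have sepP j k : j <> k ->
    {i : set_type (supp j) | U j (val i) `&` U k (val i) = set0}.
  move=> jk; apply: cid; suff [i Ui] : exists i, U j i `&` U k i = set0.
    (* Off the support of [j] the side [U j i] is the whole space and meets the nonempty [U k i]. *)
    have si : supp j i.
      by move=> UT; have [x Ux] := U0 k i; have : set0 x by rewrite -Ui UT.
    by exists (SigSub (mem_set si)).
  apply: contrapT => nsep.
  have h i : {x | (U j i `&` U k i) x}.
    apply: cid; apply: contrapT => nx; apply: nsep; exists i.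
    by apply/seteqP; split=> // x UUx; apply: nx; exists x.
  suff : set0 ((fun i => sval (h i)) : box_prod Kinf X) by [].
  rewrite -(Vdisj j k jk); split.
    by have [_ _ _] := svalP (boxV j); apply => i; have [] := svalP (h i).
  by have [_ _ _] := svalP (boxV k); apply => i; have [] := svalP (h i).
have code j : {e : set_type (supp j) -> M | injective e}.
  by apply: cid; apply/card_le_set_typeP; case: (Usupp j).
have [m0 _] := infinite_setN0 Minf.
(* Coordinates are coded by the injection belonging to [j], so [c j k = c j t] makes the two
   coordinates equal; [m0] fills the diagonal. *)
pose c j k := if pselect (j <> k) is left jk then sval (code j) (sval (sepP j k jk))
  else m0.
have cE j k (jk : j <> k) : c j k = sval (code j) (sval (sepP j k jk)).
  by rewrite /c; case: pselect => // jk'; rewrite (Prop_irrelevance jk' jk).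
have [//|[t [f [finj fc ft]]]] := end_homogeneous c ltwf lttr.
(* [i v] is where [f v] is separated from [t] and from every [f w] with [v < w]. *)
exfalso; pose i v := val (sval (sepP (f v) t (ft v))).
have it v : supp t (i v).
  move=> UT; have [x Ux] := U0 (f v) (i v).
  by have : set0 x by rewrite -(svalP (sepP (f v) t (ft v))) -/(i v) UT.
pose fib (x : set_type (supp t)) := set_type [set v | i v = val x].
(* The boxes of a fibre are pairwise disjoint at the coordinate [x], so they yield a cellular family
   in that factor. *)
have fibA x : fib x <=c A.
  apply: (XA (val x)); apply/souslin_gtP.
  exists (fun v => U (f (val v)) (val x)); split=> //.
  have Udisj v w : lt v w -> i v = val x -> U (f v) (val x) `&` U (f w) (val x) = set0.
    move=> vw <-; have := fc v w vw; rewrite !cE; first exact: finj.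
    by move=> fvw /(svalP (code (f v))); rewrite /i => <-; exact: (svalP (sepP _ _ fvw)).
  move=> v w vw; have [|[/val_inj//|]] := lttot (val v) (val w).
    by move=> /Udisj; apply; exact: (set_valP v).
  by rewrite setIC => /Udisj; apply; exact: (set_valP w).
(* The fibres cover [M], yet fewer than [M] fibres of size at most [A] make fewer than [M]
   points. *)
have /card_ltNge := card_lt_prod Minf ((card_lt_setT _ _).2 (Usupp t)) AM; apply.
apply: card_le_trans (card_le_sigT fibA); apply/card_leTP.
exists (fun v => existT fib
  (SigSub (mem_set (it v))) (SigSub (mem_set (erefl : [set u | i u = i v] v)))).
by move=> v w /(congr1 (fun p : {x & fib x} => val (projT2 p))).
Qed.

(** * Lower bounds from prescriptions on few coordinates *)

Lemma inj_cancel (T U : Type) (t0 : T) (f : T -> U) :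
  injective f -> exists h : U -> T, cancel f h.
Proof.
move=> finj.
have h u : {t | forall t', f t' = u -> t = t'}.
  apply: cid; have [[t ft]|nt] := pselect (exists t, f t = u).
    by exists t => t' ft'; apply: finj; rewrite ft ft'.
  by exists t0 => t' ft'; case: nt; exists t'.
by exists (fun u => sval (h u)) => t; rewrite (svalP (h (f t)) t).
Qed.

Lemma infinite_succ_card (A : Type) :
  infinite_set [set: succ_card A] -> infinite_set [set: A].
Proof.
move=> + Afin; apply; have /finite_setP[n An] := Afin.
have : A <c set_type `I_n.+1.
  apply/card_ltNge; rewrite card_le_setT (card_le_eqr An) card_le_II.
  by rewrite ltnn.
move=> /succ_card_le; rewrite (card_le_eqr (card_setT _)) => /card_le_finite.
by apply; exact: finite_II.
Qed.

(** Were the weak power smaller than [K], it could serve as an exponent, against Cantor's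
    theorem. *)
Lemma le_wpow_bool (K : Type) : K <=c wpow bool K.
Proof.
apply/card_leNlt => /(fun_le_wpow bool) /card_leNlt; apply.
exact: card_ltTle_trans (succ_card_lt _) (succ_card_le_fun _).
Qed.

Lemma le_wpow (A K : Type) : infinite_set [set: K] -> A <=c wpow A K.
Proof.
move=> Kinf; apply: card_le_trans (@fun_le_wpow A K unit _).
  by apply/card_leTP; exists (fun a _ => a) => a b /(congr1 (@^~ tt)).
exact: finite_set_lt finite_finset Kinf.
Qed.

(** The box of [j] has at each [i] in [D j] the member numbered [u j i] of a cellular family indexed
    by [G i], and the whole space elsewhere. *)
Lemma patterns_lt_souslin (K I J : Type) (Kinf : infinite_set [set: K])
    (X : I -> topologicalType) (G : I -> Type) (D : J -> set I)
    (u : J -> forall i, G i) :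
  (forall i, G i <c souslin (X i)) -> (forall j, D j #< [set: K]) ->
  (forall j k, j <> k -> exists i, [/\ D j i, D k i & u j i <> u k i]) ->
  J <c souslin (box_prod Kinf X).
Proof.
move=> GX DK Dsep.
have hV i : {V : G i -> set (X i) | [/\ forall g, open (V g),
    forall g, V g !=set0 & forall g h, g <> h -> V g `&` V h = set0]}.
  by apply: cid; exact/souslin_gtP.
pose V i := sval (hV i).
have Vopen i g : open (V i g) by have [+ _ _] := svalP (hV i); apply.
have V0 i g : V i g !=set0 by have [_ + _] := svalP (hV i); apply.
have Vdisj i g h : g <> h -> V i g `&` V i h = set0.
  by have [_ _] := svalP (hV i); apply.
pose U j i := if `[< D j i >] then V i (u j i) else setT.
apply: (@box_family_lt_souslin _ _ _ _ _ U).
- by move=> j i; rewrite /U; case: asboolP => // _; exact: openT.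
- move=> j i; rewrite /U; case: asboolP => // _.
  by have [x _] := V0 i (u j i); exists x.
- move=> j; apply: card_leTlt_trans (DK j); apply: subset_card_le => i /=.
  by rewrite /U; case: asboolP.
- move=> j k /Dsep[i [Dji Dki ui]]; exists i.
  by rewrite /U !asboolT //; exact: Vdisj.
Qed.

Lemma fun_bool_lt_souslin (K I : Type) (Kinf : infinite_set [set: K])
    (X : I -> topologicalType) : I <c K -> (forall i, bool <c souslin (X i)) ->
  (I -> bool) <c souslin (box_prod Kinf X).
Proof.
move=> IK boolX; apply: (@patterns_lt_souslin _ _ _ Kinf X (fun=> bool)
  (fun=> setT) (fun u i => u i)) => // f g fg.
apply: contrapT => nfg; apply: fg; apply/funext => i.
by apply: contrapT => fgi; apply: nfg; exists i.
Qed.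

(* The cardinal of [L] is coded along [K] by one block of coordinates, marking
   [phi L] and unmarking what precedes it; the other block carries the map
   [L -> bool]. *)
Lemma wpow_bool_lt_souslin (K I : Type) (Kinf : infinite_set [set: K])
    (X : I -> topologicalType) : K <=c I -> (forall i, bool <c souslin (X i)) ->
  wpow bool K <c souslin (box_prod Kinf X).
Proof.
move=> KI boolX; have [lt [ltwf lttot lttr ltseg]] := ex_initial_wo K.
have /card_leTP[phi phiinj] := cards_below_le K.
(* [e] places two copies of [K] in [I]; the boolean recovered by [h] tells the blocks apart. *)
have /card_leTP[e einj] := card_le_trans (infinite_double Kinf) KI.
have [k0 _] := infinite_setN0 Kinf.
have [h eh] := inj_cancel (true, k0) einj.
pose D (j : wpow bool K) : set I :=
  (fun v => e (true, v)) @` ([set v | lt v (phi (projT1 j))] `|` [set phi (projT1 j)])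
  `|` (fun v => e (false, v)) @` val (projT1 j).
pose f (j : wpow bool K) v : bool :=
  if pselect (val (projT1 j) v) is left jv then projT2 j (SigSub (mem_set jv)) else true.
pose u (j : wpow bool K) i : bool :=
  if (h i).1 then `[< (h i).2 = phi (projT1 j) >] else f j (h i).2.
apply: (@patterns_lt_souslin _ _ _ Kinf X (fun=> bool) D u) => //.
  move=> j; apply: card_lt_setU => //.
    apply: card_leTlt_trans (card_image_le _ _) _; apply: card_lt_setU => //.
    exact: finite_set_lt (finite_set1 _) Kinf.
  apply: card_leTlt_trans (card_image_le _ _) _.
  by case: (set_valP (projT1 j)).
have sep j k : lt (phi (projT1 j)) (phi (projT1 k)) ->
    exists i, [/\ D j i, D k i & u j i <> u k i].
  (* This coordinate is the mark of [j] and strictly precedes the mark of [k]. *)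
  move=> jk; exists (e (true, phi (projT1 j))); split.
  - by left; exists (phi (projT1 j)) => //; right.
  - by left; exists (phi (projT1 j)) => //; left.
  - rewrite /u eh /= asboolT // asboolF // => jk'.
    by apply: (wf_irrefl ltwf (x := phi (projT1 k))); rewrite -[X in lt X _]jk'.
move=> j k jk; have [|[|]] := lttot (phi (projT1 j)) (phi (projT1 k)).
- exact: sep.
- move=> /phiinj; move: j k jk => [L fj] [M fk] /= + LM; subst M => jk.
  have [x fjk] : exists x, fj x <> fk x.
    apply: contrapT => nx; apply: jk; congr existT; apply/funext => x.
    by apply: contrapT => fjk; apply: nx; exists x.
  have Lx := set_valP x.
  exists (e (false, val x)); split; try by right; exists (val x).
  rewrite /u eh /= /f /=; case: pselect => // Lx'.
  by have -> : SigSub (mem_set Lx') = x by exact: val_inj.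
- by move=> /sep[i [? ? ?]]; exists i; split=> // /esym.
Qed.

(* If all maps from [L] to the initially well-ordered [A] are bounded,
   [A ^ L] is the union of the smaller powers [a ^ L]. Otherwise fix an unbounded
   [g]; the product over [(x, y)] in [L * L] of the segments up to [g x] contains
   every [f], truncated to [f y] where this fits below [g x]. *)
Lemma fun_le_souslin (A K I L : Type) (Kinf : infinite_set [set: K])
    (X : I -> topologicalType) :
  infinite_set [set: A] -> K <=c succ_card I -> I ->
  (forall i, A <=c souslin (X i)) -> L <c K ->
  (L -> A) <=c souslin (box_prod Kinf X).
Proof.
set S := souslin _ => Ainf KI i0 AX LK.
have AS : A <=c S.
  apply/card_leNlt => SA; have : S <c S.
    (* The single coordinate [i0] would already carry [S] disjoint boxes. *)
    apply: (@patterns_lt_souslin _ _ _ Kinf X (fun=> S) (fun=> [set i0]) (fun s _ => s)).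
    - by move=> i; exact: card_ltTle_trans SA (AX i).
    - by move=> _; exact: finite_set_lt (finite_set1 _) Kinf.
    - by move=> s t st; exists i0.
  by move=> [].
have Sinf := infinite_set_le Ainf AS.
have leI (M : Type) : M <c K -> M <=c I.
  by move=> MK; apply: lt_succ_card; exact: card_ltTle_trans KI.
have rangeK (M : Type) (e : M -> I) : M <c K -> range e #< [set: K].
  exact/card_leTlt_trans/card_image_le.
have [[x0]|nL] := pselect (inhabited L); last first.
  apply: card_le_trans AS; apply/card_leTP; have [a0 _] := infinite_setN0 Ainf.
  by exists (fun=> a0) => f g _; apply/funext => x; case: nL.
have [lt [ltwf lttot lttr ltseg]] := ex_initial_wo A.
pose le a b := a = b \/ lt a b.
have leseg a : [set b | le b a] #< [set: A].
  by apply: (card_lt_setU Ainf (finite_set_lt (finite_set1 a) Ainf) (ltseg a)).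
have [[g gunb]|gbnd] := pselect (exists g : L -> A, forall a, exists x, le a (g x)).
  have LLK := card_lt_prod Kinf LK LK.
  have /card_leTP[e einj] := leI _ LLK.
  have [h eh] := inj_cancel (x0, x0) einj.
  pose G i := set_type [set a | le a (g (h i).1)].
  (* With [(x, y)] decoded from [i], the value is [f y] if this fits below [g x], and [g x]
     otherwise. *)
  have v (f : L -> A) i : {a : G i | le (f (h i).2) (g (h i).1) -> val a = f (h i).2}.
    apply: cid; have [fg|nfg] := pselect (le (f (h i).2) (g (h i).1)).
      by exists (SigSub (mem_set (fg : [set a | le a (g (h i).1)] _))).
    have gg : [set a | le a (g (h i).1)] (g (h i).1) by left.
    by exists (SigSub (mem_set gg)).
  suff [] : (L -> A) <c S by [].
  apply: (@patterns_lt_souslin _ _ _ Kinf X G (fun=> range e) (fun f i => sval (v f i))).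
  - by move=> i; apply: card_ltTle_trans (AX i); exact/card_lt_setT.
  - by move=> _; exact: rangeK.
  move=> f f' ff'; have [y fy] : exists y, f y <> f' y.
    apply: contrapT => ny; apply: ff'; apply/funext => y.
    by apply: contrapT => fy; apply: ny; exists y.
  (* Unboundedness of [g] gives an [x] at which neither value is truncated. *)
  have [x [fx f'x]] : exists x, le (f y) (g x) /\ le (f' y) (g x).
    have letr a b c : le a b -> le b c -> le a c.
      by move=> [->//|ab] [<-|bc]; right=> //; exact: lttr bc.
    have main a b : le a b -> exists x, le a (g x) /\ le b (g x).
      by move=> ab; have [x bx] := gunb b; exists x; split=> //; exact: letr bx.
    have [ltff'|[eqff'|/or_intror/main[x []]]] := lttot (f y) (f' y); last by exists x.
      by apply: main; right.
    by apply: main; left.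
  exists (e (x, y)); split; [by exists (x, y)|by exists (x, y)|].
  have vE f0 : le (f0 y) (g x) -> val (sval (v f0 (e (x, y)))) = f0 y.
    by move=> f0x; rewrite (svalP (v f0 (e (x, y)))) eh.
  by move=> /(congr1 val); rewrite !vE.
have bnd (f : L -> A) : {a | forall x, lt (f x) a}.
  apply: cid; apply: contrapT => na; apply: gbnd; exists f => a.
  apply: contrapT => nx; apply: na; exists a => x.
  have [//|h] := lttot (f x) a; exfalso; apply: nx; exists x.
  by case: h => [->|]; [left|right].
(* The maps bounded by [a]; the segment of [a] is smaller than [A], so every factor has a cellular
   family indexed by it. *)
pose F a := L -> set_type [set b | lt b a].
apply: (@card_le_trans _ _ _ [set: {a & F a}]).
  apply/card_leTP; exists (fun f => existT F (sval (bnd f))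
    (fun x => SigSub (mem_set (svalP (bnd f) x)))) => f f'.
  by move=> /(congr1 (fun (p : {a & F a}) x => val (projT2 p x))).
apply: card_le_sigT_infinite => // a.
have /card_leTP[e einj] := leI _ LK; have [h eh] := inj_cancel x0 einj.
suff [] : F a <c S by [].
apply: (@patterns_lt_souslin _ _ _ Kinf X (fun=> set_type [set b | lt b a])
  (fun=> range e) (fun f i => f (h i))).
- by move=> i; apply: card_ltTle_trans (AX i); exact/card_lt_setT.
- by move=> _; exact: rangeK.
move=> f f' ff'; have [y fy] : exists y, f y <> f' y.
  apply: contrapT => ny; apply: ff'; apply/funext => y.
  by apply: contrapT => fy; apply: ny; exists y.
by exists (e y); rewrite eh; split=> //; exists y.
Qed.

(** * The two cases of the theorem *)

Theorem corollary5p35 (A K I : Type) (X : I -> topologicalType)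
    (A_ge3 : 'I_3 <=c A) (Kinf : infinite_set [set: K])
    (I_K : K <=c succ_card I)
    (S_X : forall i, A <=c souslin (X i) /\ souslin (X i) <=c succ_card A) :
  (K <=c succ_card A ->
     wpow A K <=c souslin (box_prod Kinf X) /\
     souslin (box_prod Kinf X) <=c succ_card (A -> bool)) /\
  (succ_card A <=c K ->
     succ_card (wpow bool K) <=c souslin (box_prod Kinf X) /\
     souslin (box_prod Kinf X) <=c succ_card (wpow (wpow bool K) K)).
Proof.
have Iinf : infinite_set [set: I] by exact/infinite_succ_card/(infinite_set_le Kinf).
have [i0 _] := infinite_setN0 Iinf.
have cellX i (J : Type) : J <c souslin (X i) -> J <=c A.
  by move=> JX; apply: lt_succ_card; apply: card_ltTle_trans JX _; case: (S_X i).
split=> [KA|AK].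
  have sAinf := infinite_set_le Kinf KA.
  have Ainf := infinite_succ_card sAinf.
  have powAA := fun_le_souslin Kinf Ainf I_K i0 (fun i => (S_X i).1).
  have A2inf : infinite_set [set: A -> bool].
    exact: infinite_set_le sAinf (succ_card_le_fun A).
  split.
    have AS : A <=c souslin (box_prod Kinf X).
      apply: card_le_trans (powAA unit (finite_set_lt finite_finset Kinf)).
      by apply/card_leTP; exists (fun a _ => a) => a b /(congr1 (@^~ tt)).
    apply: wpow_le => //; first exact: infinite_set_le AS.
    apply: card_le_trans (cards_below_le K) _.
    (* If [A] is smaller than [K], it is an admissible exponent, and [K] is at most [succ_card A],
       hence at most 2^A, A^A and the Souslin number. *)
    have [KleA|AltK] := pselect (K <=c A); first exact: card_le_trans AS.
    apply: card_le_trans KA _; apply: card_le_trans (succ_card_le_fun A) _.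
    apply: card_le_trans (powAA A _); last exact/card_ltNge.
    apply: card_le_fun_codom.
    exact: (finite_set_lt (@finite_finset bool setT) Ainf).1.
  apply: souslin_le_succ => J JS.
  (* Proper segments have at most [A] points, so the colourings of one number at most (2^A)^A =
     2^A. *)
  have [lt ltwo] := ex_initial_wo (succ_card A).
  apply: card_le_trans (box_prod_cellular_le ltwo sAinf KA (succ_card_lt A) cellX JS) _.
  apply: card_le_sigT_infinite => //; first exact: succ_card_le_fun.
  move=> w; have [a0 _] := infinite_setN0 sAinf.
  apply: card_le_trans (@card_le_fun_dom _ A _ a0 _) _.
    by apply: lt_succ_card; apply/card_lt_setT; case: ltwo.
  apply: card_le_trans (card_le_fun_codom A (succ_card_le_fun A)) _.
  apply: card_le_trans (card_le_curry _ _ _) _.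
  exact: card_le_fun_dom true (infinite_square Ainf).
have AltK : A <c K by exact: card_ltTle_trans (succ_card_lt A) AK.
(* The bound 3 provides two disjoint nonempty open sets in each factor. *)
have boolX i : bool <c souslin (X i).
  apply: card_ltTle_trans (card_le_trans A_ge3 (S_X i).1).
  apply/card_ltNge => /card_leTP[f /leq_card]; by rewrite card_ord card_bool.
split.
  (* If [I] is smaller than [K], exponents below [K] are still at most [I] by [I_K], so the weak
     power is at most 2^I. *)
  apply: succ_card_le; have [KI|/card_ltNge IK] := pselect (K <=c I).
    exact: wpow_bool_lt_souslin.
  apply: card_leTlt_trans (fun_bool_lt_souslin Kinf IK boolX).
  have KI2 := card_le_trans I_K (succ_card_le_fun I).
  apply: wpow_le; first exact: infinite_set_le KI2.
    exact: card_le_trans (cards_below_le K) KI2.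
  move=> L LK; apply: (card_le_fun_dom true); apply: lt_succ_card.
  exact: card_ltTle_trans LK I_K.
(* Now the length is [K]; as [K] is at most [wpow bool K], the colourings of each segment embed into
   the outer weak power. *)
apply: souslin_le_succ => J JS; have [lt ltwo] := ex_initial_wo K.
apply: card_le_trans (box_prod_cellular_le ltwo Kinf (card_lexx _) AltK cellX JS) _.
have KB := le_wpow_bool K; have BW := le_wpow (wpow bool K) Kinf.
have KW := card_le_trans KB BW.
apply: card_le_sigT_infinite => //; first exact: infinite_set_le KW.
move=> w; apply: card_le_trans (card_le_fun_codom _ KB) _; apply: fun_le_wpow.
by apply/card_lt_setT; case: ltwo.
Qed.
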